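(* For all integers $m,n,k\ge 0$ there is an isomorphism of $\mathbb{C}$-algebras $$\mathcal{C}(2m+n,2k)\;\simeq\;\mathcal{C}(2m)\otimes\mathcal{C}(n,2k),$$ where $\otimes$ is the ordinary (ungraded) tensor product of algebras over $\mathbb{C}$.
   Context: All algebras are unital associative over $\mathbb{C}$. For $n,k\ge 0$ the Clifford--Weyl algebra $\mathcal{C}(n,2k)$ is the algebra with generators $\omega_1,\dots,\omega_n,p_1,q_1,\dots,p_k,q_k$ and relations $\omega_i\omega_j+\omega_j\omega_i=2\delta_{ij}$; $p_iq_j-q_jp_i=\delta_{ij}$, $p_ip_j=p_jp_i$, $q_iq_j=q_jq_i$; $\omega_ip_j+p_j\omega_i=0$, $\omega_iq_j+q_j\omega_i=0$ for all $i,j$. The Clifford algebra is $\mathcal{C}(n)=\mathcal{C}(n,0)$. *)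

(* Defs.v *)
(* MathComp, with classical logic used to decide membership in ideals. *)
From HB Require Import structures.
From mathcomp Require Import all_boot all_algebra.
From mathcomp Require Import finmap.
From mathcomp Require Import boolp classical_sets reals.
From mathcomp.multinomials Require Import monalg.
From mathcomp.real_closed Require Import complex.

Set Implicit Arguments.
Unset Strict Implicit.
Unset Printing Implicit Defensive.

Import GRing.Theory.
Local Open Scope ring_scope.
Local Open Scope quotient_scope.

(* Quotient of an algebra by a two-sided ideal.  MathComp's algType includes
   1 != 0, hence the condition that the ideal be proper; closure under scaling
   follows from c *: x = (c *: 1) * x. *)
Record twoSidedIdeal (A : nzRingType) := TwoSidedIdeal {
  ideal_pred :> A -> bool;
  ideal_zmod : zmod_closed ideal_pred;
  ideal_mull : forall a, {in ideal_pred, forall x, a * x \in ideal_pred};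
  ideal_mulr : forall a, {in ideal_pred, forall x, x * a \in ideal_pred};
  ideal_proper : 1 \notin ideal_pred
}.

HB.instance Definition _ (A : nzRingType) (I : twoSidedIdeal A) :=
  GRing.isZmodClosed.Build A (ideal_pred I) (ideal_zmod I).

Section QuotientAlgebra.
Context (R : comNzRingType) (A : algType R) (I : twoSidedIdeal A).

Definition quotAlg : Type :=
  Quotient.quot (GRing.ZmodClosed.clone A (ideal_pred I) _).

HB.instance Definition _ := GRing.Zmodule.on quotAlg.

Definition quot_pi (x : A) : quotAlg := \pi_(Quotient.quot _) x.
Definition quot_repr (u : quotAlg) : A :=
  repr (u : Quotient.quot _).

Lemma quot_reprK (u : quotAlg) : quot_pi (quot_repr u) = u.
Proof. exact: reprK. Qed.

Lemma quot_piP x y : quot_pi x = quot_pi y <-> x - y \in ideal_pred I.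
Proof. by rewrite Quotient.idealrBE; split=> /eqP. Qed.

Lemma quot_piD : {morph quot_pi : x y / x + y}.
Proof. by move=> x y; rewrite /quot_pi Quotient.pi_add. Qed.

Let repr_pi x : quot_repr (quot_pi x) - x \in ideal_pred I.
Proof. exact/quot_piP/quot_reprK. Qed.

(* The induced operations are sealed (by Qed), since unfolding them down to
   the operations of A makes conversion very slow. *)
Fact quot_mul_subdef : {mul : quotAlg -> quotAlg -> quotAlg |
  forall x y, mul (quot_pi x) (quot_pi y) = quot_pi (x * y)}.
Proof.
exists (fun u v => quot_pi (quot_repr u * quot_repr v)) => x y; apply/quot_piP.
set x' := quot_repr (quot_pi x); set y' := quot_repr (quot_pi y).
have -> : x' * y' - x * y = (x' - x) * y' + x * (y' - y).
  by rewrite mulrBl mulrBr addrA subrK.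
by apply: rpredD; [apply: ideal_mulr|apply: ideal_mull]; apply: repr_pi.
Qed.

Fact quot_scale_subdef : {scale : R -> quotAlg -> quotAlg |
  forall c x, scale c (quot_pi x) = quot_pi (c *: x)}.
Proof.
exists (fun c u => quot_pi (c *: quot_repr u)) => c x; apply/quot_piP.
rewrite -scalerBr -[_ - _]mul1r scalerAl.
by apply: ideal_mull; apply: repr_pi.
Qed.

Definition quot_one : quotAlg := quot_pi 1.
Definition quot_mul : quotAlg -> quotAlg -> quotAlg := sval quot_mul_subdef.
Definition quot_scale : R -> quotAlg -> quotAlg := sval quot_scale_subdef.

Lemma quot_piM x y : quot_mul (quot_pi x) (quot_pi y) = quot_pi (x * y).
Proof. exact: svalP quot_mul_subdef x y. Qed.

Lemma quot_piZ c x : quot_scale c (quot_pi x) = quot_pi (c *: x).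
Proof. exact: svalP quot_scale_subdef c x. Qed.

Let quotE := (quot_piM, quot_piZ, =^~ quot_piD).

Lemma quot_mulA : associative quot_mul.
Proof.
by move=> u v w; rewrite -[u]quot_reprK -[v]quot_reprK -[w]quot_reprK
  !quotE mulrA.
Qed.
Lemma quot_mul1r : left_id quot_one quot_mul.
Proof. by move=> u; rewrite -[u]quot_reprK !quotE mul1r. Qed.
Lemma quot_mulr1 : right_id quot_one quot_mul.
Proof. by move=> u; rewrite -[u]quot_reprK !quotE mulr1. Qed.
Lemma quot_mulDl : left_distributive quot_mul +%R.
Proof.
by move=> u v w; rewrite -[u]quot_reprK -[v]quot_reprK -[w]quot_reprK
  !quotE mulrDl.
Qed.
Lemma quot_mulDr : right_distributive quot_mul +%R.
Proof.
by move=> u v w; rewrite -[u]quot_reprK -[v]quot_reprK -[w]quot_reprK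
  !quotE mulrDr.
Qed.
Lemma quot_oner_neq0 : quot_one != 0.
Proof.
have -> : 0 = quot_pi 0 by apply: (addrI (quot_pi 0)); rewrite -quot_piD !addr0.
by apply/eqP => /quot_piP; rewrite subr0; apply/negP/ideal_proper.
Qed.

HB.instance Definition _ := GRing.Zmodule_isNzRing.Build quotAlg
  quot_mulA quot_mul1r quot_mulr1 quot_mulDl quot_mulDr quot_oner_neq0.

Lemma quot_scalerA c d u : quot_scale c (quot_scale d u) = quot_scale (c * d) u.
Proof. by rewrite -[u]quot_reprK !quotE scalerA. Qed.
Lemma quot_scale1r : left_id 1 quot_scale.
Proof. by move=> u; rewrite -[u]quot_reprK !quotE scale1r. Qed.
Lemma quot_scalerDr : right_distributive quot_scale +%R.
Proof.
by move=> c u v; rewrite -[u]quot_reprK -[v]quot_reprK !quotE scalerDr.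
Qed.
Lemma quot_scalerDl u : {morph quot_scale^~ u : c d / c + d}.
Proof. by move=> c d; rewrite -[u]quot_reprK !quotE scalerDl. Qed.

HB.instance Definition _ := GRing.Zmodule_isLmodule.Build R quotAlg
  quot_scalerA quot_scale1r quot_scalerDr quot_scalerDl.

Lemma quot_scalerAl (c : R) (u v : quotAlg) : c *: (u * v) = (c *: u) * v.
Proof.
rewrite /GRing.mul/= /GRing.scale/= -[u]quot_reprK -[v]quot_reprK.
by rewrite !quotE scalerAl.
Qed.
HB.instance Definition _ := GRing.Lmodule_isLalgebra.Build R quotAlg
  quot_scalerAl.

Lemma quot_scalerAr (c : R) (u v : quotAlg) : c *: (u * v) = u * (c *: v).
Proof.
rewrite /GRing.mul/= /GRing.scale/= -[u]quot_reprK -[v]quot_reprK.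
by rewrite !quotE scalerAr.
Qed.
HB.instance Definition _ := GRing.Lalgebra_isAlgebra.Build R quotAlg
  quot_scalerAr.

End QuotientAlgebra.

Section IdealGeneratedBy.
Context (A : nzRingType) (S : A -> Prop).

Inductive in_ideal : A -> Prop :=
| in_ideal_gen x : S x -> in_ideal x
| in_ideal0 : in_ideal 0
| in_idealD x y : in_ideal x -> in_ideal y -> in_ideal (x + y)
| in_ideal_mull a x : in_ideal x -> in_ideal (a * x)
| in_ideal_mulr a x : in_ideal x -> in_ideal (x * a).

Lemma in_ideal_zmod : zmod_closed (fun x => `[< in_ideal x >]).
Proof.
split=> [|x y /asboolP Ix /asboolP Iy]; apply/asboolP; first exact: in_ideal0.
by apply: in_idealD => //; rewrite -mulN1r; apply: in_ideal_mull.
Qed.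

Definition ideal_gen_by (S1 : ~ in_ideal 1) : twoSidedIdeal A.
Proof.
apply: (@TwoSidedIdeal A (fun x => `[< in_ideal x >]) in_ideal_zmod).
- by move=> a x /asboolP Ix; apply/asboolP; apply: in_ideal_mull.
- by move=> a x /asboolP Ix; apply/asboolP; apply: in_ideal_mulr.
- by apply/negP=> /asboolP.
Defined.

End IdealGeneratedBy.

(* The free module {malg R[K]} on a set K, with basis << x >> for x : K. *)
Section FreeModule.
Context (R : comNzRingType) (K : choiceType) (V : lmodType R).

Definition malg_ext (h : K -> V) (g : {malg R[K]}) : V :=
  \sum_(x <- msupp g) g@_x *: h x.

Lemma malg_extEw h (d : {fset K}) g : (msupp g `<=` d)%fset ->
  malg_ext h g = \sum_(x <- d) g@_x *: h x.
Proof.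
move=> le; rewrite /malg_ext (big_fset_incl _ le) //= => x xd.
by move/mcoeff_outdom ->; rewrite scale0r.
Qed.

Lemma malg_extU h c x : malg_ext h << c *g x >> = c *: h x.
Proof. by rewrite (malg_extEw h msuppU_le) big_seq_fset1 mcoeffUU. Qed.

Lemma malg_ext_is_linear h : linear (malg_ext h).
Proof.
move=> c f g; pose d := (msupp f `|` msupp g `|` msupp (c *: f + g))%fset.
rewrite !(malg_extEw h (d := d)) ?fsubsetUr //.
- rewrite scaler_sumr -big_split; apply: eq_bigr => x _ /=.
  by rewrite mcoeffD mcoeffZ scalerDl scalerA.
- by apply/fsubsetP => y yg; rewrite !in_fsetU yg orbT.
- by apply/fsubsetP => y yf; rewrite !in_fsetU yf.
Qed.

HB.instance Definition _ h :=
  GRing.isLinear.Build R {malg R[K]} V _ (malg_ext h) (malg_ext_is_linear h).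

End FreeModule.

Lemma malg_ind (R : comNzRingType) (K : choiceType) (P : {malg R[K]} -> Prop) :
  P 0 -> (forall f g, P f -> P g -> P (f + g)) ->
  (forall c x, P << c *g x >>) -> forall g, P g.
Proof. by move=> P0 PD PU g; rewrite (monalgE g); apply: big_ind. Qed.

Lemma malgZU (R : comNzRingType) (K : choiceType) (c d : R) (x : K) :
  c *: << d *g x >> = << c * d *g x >>.
Proof. by apply/malgP => y; rewrite mcoeffZ !mcoeffU mulrnAr. Qed.

(* The free algebra on X is the monoid algebra of the free monoid {fmonom X}. *)
Section FreeAlgebra.
Context (R : comNzRingType) (X : choiceType).

Definition freeAlg : Type := {malg R[{fmonom X}]}.
HB.instance Definition _ := GRing.Lalgebra.on freeAlg.

Lemma freeAlg_ind (P : freeAlg -> Prop) :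
  P 0 -> (forall x y : freeAlg, P x -> P y -> P (x + y)) ->
  (forall c m, P << c *g m >>) -> forall x, P x.
Proof. exact: malg_ind. Qed.

Lemma freeAlg_mulUU (c d : R) (u v : {fmonom X}) :
  (<< c *g u >> : freeAlg) * << d *g v >> = << c * d *g mmul u v >>.
Proof. exact: fgmulUU. Qed.

Lemma freeAlgZU (c d : R) (u : {fmonom X}) :
  c *: (<< d *g u >> : freeAlg) = << c * d *g u >>.
Proof. exact: malgZU. Qed.

Lemma freeAlg_scalerAr (c : R) (x y : freeAlg) : c *: (x * y) = x * (c *: y).
Proof.
elim/freeAlg_ind: x => [|x x' IHx IHx'|d u]; first by rewrite 2!mul0r scaler0.
  rewrite 2!mulrDl scalerDr.
  exact: (f_equal2 +%R IHx IHx').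
elim/freeAlg_ind: y => [|y y' IHy IHy'|e v]; first by rewrite mulr0 scaler0 mulr0.
  rewrite (scalerDr c y y') 2!mulrDr scalerDr.
  exact: (f_equal2 +%R IHy IHy').
by rewrite freeAlg_mulUU 2!freeAlgZU freeAlg_mulUU mulrCA.
Qed.

HB.instance Definition _ := GRing.Lalgebra_isAlgebra.Build R freeAlg
  freeAlg_scalerAr.

Definition free_gen (x : X) : freeAlg := << fmu x >>.

End FreeAlgebra.

Section CliffordWeyl.
Context (R : comNzRingType) (n k : nat).

Definition cw_index : choiceType := ('I_n + ('I_k + 'I_k))%type.

Notation F := (freeAlg R cw_index).
Definition cw_omega (i : 'I_n) : F := free_gen R (inl i : cw_index).
Definition cw_p (i : 'I_k) : F := free_gen R (inr (inl i) : cw_index).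
Definition cw_q (i : 'I_k) : F := free_gen R (inr (inr i) : cw_index).

Notation w := cw_omega.
Notation p := cw_p.
Notation q := cw_q.

Inductive cw_relator : F -> Prop :=
| cw_ww i j : cw_relator (w i * w j + w j * w i - 2 * (i == j)%:R)
| cw_pq i j : cw_relator (p i * q j - q j * p i - (i == j)%:R)
| cw_pp i j : cw_relator (p i * p j - p j * p i)
| cw_qq i j : cw_relator (q i * q j - q j * q i)
| cw_wp i j : cw_relator (w i * p j + p j * w i)
| cw_wq i j : cw_relator (w i * q j + q j * w i).

(* The relations do not force 1 = 0: the algebra acts on the functions of
   (s, a), s : 'I_n -> bool, a : 'I_k -> nat, by weighted shifts; omega_i is a
   Jordan-Wigner matrix, p_i and q_i are d/dx_i and x_i times the parity of s. *)
Notation T := ({ffun 'I_n -> bool} * {ffun 'I_k -> nat})%type.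

Definition cw_shift (x : cw_index) (t : T) : T :=
  match x with
  | inl i => ([ffun j => t.1 j (+) (j == i)], t.2)
  | inr (inl i) => (t.1, [ffun j => t.2 j + (j == i)]%N)
  | inr (inr i) => (t.1, [ffun j => t.2 j - (j == i)]%N)
  end.

Definition cw_sign (P : pred 'I_n) (t : T) : R := \prod_(l | P l) (-1) ^+ t.1 l.

Definition cw_coef (x : cw_index) (t : T) : R :=
  match x with
  | inl i => cw_sign (fun l => l < i)%N t
  | inr (inl i) => cw_sign predT t * (t.2 i).+1%:R
  | inr (inr i) => cw_sign predT t * (0 < t.2 i)%N%:R
  end.

Fixpoint cw_wcoef (m : seq cw_index) (t : T) : R :=
  if m is x :: m' then cw_coef x t * cw_wcoef m' (cw_shift x t) else 1.

Definition cw_wshift (m : seq cw_index) (t : T) : T :=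
  foldl (fun t x => cw_shift x t) t m.

Definition cw_rep (f : T -> R) (t : T) : F -> R^o :=
  malg_ext (fun m : {fmonom cw_index} =>
    cw_wcoef m t * f (cw_wshift m t) : R^o).

Lemma cw_repU c m f t :
  cw_rep f t << c *g m >> = c * (cw_wcoef m t * f (cw_wshift m t)).
Proof. exact: malg_extU. Qed.

Lemma cw_repD f t x y : cw_rep f t (x + y) = cw_rep f t x + cw_rep f t y.
Proof. exact: linearD. Qed.

Lemma cw_rep0 f t : cw_rep f t 0 = 0.
Proof. exact: linear0. Qed.

Lemma cw_repN f t x : cw_rep f t (- x) = - cw_rep f t x.
Proof. exact: linearN. Qed.

Lemma cw_rep1 f t N : cw_rep f t N%:R = f t *+ N.
Proof.
have -> : cw_rep f t N%:R = cw_rep f t 1 *+ N by exact: linearMn.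
by rewrite [cw_rep f t 1]cw_repU fm1 /= !mul1r.
Qed.

Lemma cw_wcoef_cat m m' t :
  cw_wcoef (m ++ m') t = cw_wcoef m t * cw_wcoef m' (cw_wshift m t).
Proof. by elim: m t => [|x m IH] t /=; rewrite ?mul1r // IH mulrA. Qed.

Lemma cw_repM f t x y : cw_rep f t (x * y) = cw_rep (fun s => cw_rep f s y) t x.
Proof.
elim/freeAlg_ind: x => [|x x' IHx IHx'|c u]; first by rewrite mul0r !cw_rep0.
  rewrite mulrDl 2!cw_repD.
  exact: (f_equal2 +%R IHx IHx').
elim/freeAlg_ind: y => [|y y' IHy IHy'|d v].
- by rewrite mulr0 cw_repU !cw_rep0 !mulr0.
- rewrite mulrDr cw_repD; apply: (etrans (f_equal2 +%R IHy IHy')).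
  rewrite 3!cw_repU cw_repD.
  by rewrite -mulrDr -[RHS]/(_ * (_ * _)) -mulrDr.
rewrite freeAlg_mulUU 3!cw_repU /= fmM cw_wcoef_cat.
by rewrite /cw_wshift foldl_cat !mulrA; congr (_ * _ * _); rewrite mulrAC.
Qed.

Lemma cw_rep_gen x f t :
  cw_rep f t (free_gen R x) = cw_coef x t * f (cw_shift x t).
Proof. by rewrite cw_repU fmU /= mul1r mulr1. Qed.

Lemma cw_sign_flip P i t :
  cw_sign P (cw_shift (inl i) t) = (-1) ^+ P i * cw_sign P t.
Proof.
rewrite /cw_sign /= [RHS]mulrC.
transitivity (\prod_(l | P l) ((-1) ^+ t.1 l * (-1) ^+ (l == i)) : R).
  by apply: eq_bigr => l _; rewrite ffunE signr_addb.
rewrite big_split /=; congr (_ * _).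
rewrite big_mkcond (bigD1 i) //= eqxx big1 ?mulr1; first by case: (P i).
by move=> l /negbTE ->; rewrite if_same.
Qed.

Lemma cw_sign_sqr P t : cw_sign P t * cw_sign P t = 1.
Proof.
rewrite /cw_sign -big_split /= big1 // => l _.
by rewrite -expr2 sqrr_sign.
Qed.

Definition cw_word2 f t x y :=
  cw_coef x t * cw_coef y (cw_shift x t) * f (cw_shift y (cw_shift x t)).

Lemma cw_rep_gen2 f t x y :
  cw_rep f t (free_gen R x * free_gen R y) = cw_word2 f t x y.
Proof. by rewrite cw_repM 2!cw_rep_gen mulrA. Qed.

Lemma cw_rep_add2 f t x y x' y' :
  cw_rep f t (free_gen R x * free_gen R y + free_gen R x' * free_gen R y') =
  cw_word2 f t x y + cw_word2 f t x' y'.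
Proof. by rewrite cw_repD; congr (_ + _); apply: cw_rep_gen2. Qed.

Lemma cw_rep_sub2 f t x y x' y' :
  cw_rep f t (free_gen R x * free_gen R y - free_gen R x' * free_gen R y') =
  cw_word2 f t x y - cw_word2 f t x' y'.
Proof.
by rewrite cw_repD cw_repN; congr (_ - _); apply: cw_rep_gen2.
Qed.

Lemma cw_rep_subn f t z e N : e = N%:R ->
  cw_rep f t (z - e) = cw_rep f t z - f t *+ N.
Proof. by move=> ->; rewrite cw_repD cw_repN cw_rep1. Qed.

Lemma cw_rep_relator z : cw_relator z -> forall f t, cw_rep f t z = 0.
Proof.
have sgn t : cw_sign predT t * cw_sign predT t = 1 by exact: cw_sign_sqr.
case=> [] i j f [s a].
- rewrite (cw_rep_subn _ _ _ (N := 2 * (i == j))) ?natrM // cw_rep_add2.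
  rewrite /cw_word2 /= 2!(cw_sign_flip _ _ (s, a)).
  have [->|ij] := eqVneq i j.
    rewrite ltnn expr0 !mul1r cw_sign_sqr mul1r.
    set g := f _; have -> : g = f (s, a).
      by congr (f (_, _)); apply/ffunP => l; rewrite !ffunE addbK.
    by rewrite muln1 mulr2n subrr.
  rewrite muln0 mulr0n subr0.
  set fl := f _; set fr := f _.
  have -> : fr = fl.
    by congr (f (_, _)); apply/ffunP => l; rewrite !ffunE addbAC.
  rewrite -mulrDl mulrCA [X in _ + X]mulrCA [X in _ + _ * X]mulrC -mulrDl.
  move: ij; rewrite -val_eqE neq_ltn /=.
  by case: ltngtP => //= _ _; rewrite expr1 expr0 ?addNr ?addrN !mul0r.
- rewrite (cw_rep_subn _ _ _ (N := (i == j))) // cw_rep_sub2.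
  rewrite /cw_word2 /= mulrACA sgn mul1r mulrACA sgn mul1r !ffunE.
  have [->|ij] := eqVneq i j.
    rewrite (_ : nat_of_bool true = 1%N) // addn1 ltn0Sn mulr1.
    set g := f _; have -> : g = f (s, a).
      by congr (f (_, _)); apply/ffunP => l; rewrite !ffunE addnK.
    case: (ltnP 0 (a j)) => [aj|]; last first.
      by rewrite leqn0 => /eqP ->; rewrite !mul0r subr0 mul1r subrr.
    have -> : [ffun j0 => ([ffun j1 => a j1 - (j1 == j)] j0 + (j0 == j))%N] = a.
      apply/ffunP => l; rewrite !ffunE subnK //.
      by have [->|] := eqVneq l j.
    by rewrite subn1 prednK // mul1r -mulrBl -natrB // subSnn mul1r subrr.
  rewrite addn0 subn0 mulr0n subr0 [X in _ - X * _]mulrC.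
  set fl := f _; set fr := f _; have -> : fr = fl.
    congr (f (_, _)); apply/ffunP => l; rewrite !ffunE.
    have [->|] := eqVneq l i; first by rewrite (negbTE ij) !subn0.
    by rewrite !addn0.
  by rewrite subrr.
- rewrite cw_rep_sub2 /cw_word2 /= mulrACA sgn mul1r mulrACA sgn mul1r !ffunE.
  set fl := f _; set fr := f _; have -> : fr = fl.
    by congr (f (_, _)); apply/ffunP => l; rewrite !ffunE addnAC.
  have [->|ij] := eqVneq i j; first by rewrite subrr.
  by rewrite !addn0 [X in _ - X * _]mulrC subrr.
- rewrite cw_rep_sub2 /cw_word2 /= mulrACA sgn mul1r mulrACA sgn mul1r !ffunE.
  set fl := f _; set fr := f _; have -> : fr = fl.
    by congr (f (_, _)); apply/ffunP => l; rewrite !ffunE subnAC.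
  have [->|ij] := eqVneq i j; first by rewrite subrr.
  by rewrite !subn0 [X in _ - X * _]mulrC subrr.
- rewrite cw_rep_add2 /cw_word2 /= (cw_sign_flip predT i (s, a)) expr1 mulN1r.
  by rewrite !mulNr mulrN mulNr addrC [X in _ - X * _]mulrC subrr.
- rewrite cw_rep_add2 /cw_word2 /= (cw_sign_flip predT i (s, a)) expr1 mulN1r.
  by rewrite !mulNr mulrN mulNr addrC [X in _ - X * _]mulrC subrr.
Qed.

Lemma cw_rep_ideal z : in_ideal cw_relator z -> forall f t, cw_rep f t z = 0.
Proof.
elim=> {z} [z /cw_rep_relator //||x y _ IHx _ IHy|a x _ IH|a x _ IH] f t.
- exact: cw_rep0.
- by rewrite cw_repD IHx IHy addr0.
- rewrite cw_repM; under eq_fun do rewrite IH.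
  by rewrite /cw_rep /malg_ext big1 // => m _; rewrite mulr0 scaler0.
- by rewrite cw_repM IH.
Qed.

Lemma cw_proper : ~ in_ideal cw_relator 1.
Proof.
move/cw_rep_ideal => /(_ (fun=> 1) ([ffun=> false], [ffun=> 0%N])).
by rewrite (cw_rep1 _ _ 1); apply/eqP/oner_neq0.
Qed.

(* The second argument counts the pairs (p_i, q_i): cliffordWeyl R n k is the
   algebra written C(n, 2k). *)
Definition cliffordWeyl : algType R := quotAlg (ideal_gen_by cw_proper).

End CliffordWeyl.

Definition clifford (R : comNzRingType) (n : nat) : algType R :=
  cliffordWeyl R n 0.

(* Over a field, some linear functional takes the value 1 at a nonzero vector;
   it is used to show that a tensor product of nonzero algebras is nonzero. *)
Lemma linear_functional_eq1 (K : fieldType) (V : lmodType K) (e : V) :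
  e != 0 -> exists phi : {linear V -> K^o}, phi e = 1.
Proof.
move=> e0.
pose lin (W : set V) := forall c x y, W x -> W y -> W (c *: x + y).
pose P (W : set V) := lin W /\ ~ W e.
have [F FP Ftot|W [[Wlin We] Wmax]] := @Zorn_bigcup V P.
  split=> [c x y [X FX Xx] [Y FY Yy]|[X FX]]; last exact: (FP _ FX).2.
  have [XY|YX] := Ftot _ _ FX FY.
    by exists Y => //; apply: (FP _ FY).1 => //; apply: XY.
  by exists X => //; apply: (FP _ FX).1 => //; apply: YX.
have maxW (B : set V) : (W `<=` B)%classic -> P B -> (B `<=` W)%classic.
  move=> WB PB x Bx; apply: contrapT => Wx; apply: (Wmax B) => //.
  by split=> // BW; apply/Wx/BW.
have W0 : W 0.
  apply: (maxW [set x | W x \/ x = 0]%classic); [by left| |by right].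
  split=> [c x y|]; last by case=> // /eqP; apply/negP.
  case=> [Wx|->] [Wy|->]; rewrite ?scaler0 ?addr0 ?add0r; try by [left|right].
  - by left; apply: Wlin.
  - by left; rewrite -[c](subrK 1) scalerDl scale1r; apply: Wlin.
have WZ c x : W x -> W (c *: x) by move=> Wx; rewrite -[_ *: _]addr0; apply: Wlin.
have WB x y : W x -> W y -> W (x - y).
  by move=> Wx Wy; rewrite addrC -scaleN1r; apply: Wlin.
have Wcoord a : exists c, W (a - c *: e).
  pose B := [set x | exists d, W (x - d *: a)]%classic.
  have [[d Wd]|Be] := pselect (B e).
    have d0 : d != 0 by apply: contra_notN We => /eqP d0; move: Wd; rewrite d0 scale0r subr0.
    exists d^-1; have := WZ (- d^-1) _ Wd.
    by rewrite scalerBr scalerA mulNr mulVf // !scaleNr scale1r opprK addrC.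
  exists 0; rewrite scale0r subr0; apply: (maxW B); first 2 last.
  - by exists 1; rewrite scale1r subrr.
  - by move=> x Wx; exists 0; rewrite scale0r subr0.
  split=> // c x y [d Wx] [d' Wy]; exists (c * d + d').
  by rewrite scalerDl -scalerA opprD addrACA -scalerBr; apply: Wlin.
pose f a : K^o := sval (cid (Wcoord a)).
have fP a : W (a - f a *: e) by rewrite /f; case: cid.
have f_uniq a c : W (a - c *: e) -> f a = c.
  move=> Wc; apply/eqP; rewrite -subr_eq0; apply: contra_notT We => d0.
  have := WZ (f a - c)^-1 _ (WB _ _ Wc (fP a)).
  by rewrite opprB [_ + (_ - a)]addrC addrA subrK -scalerBl scalerA mulVf // scale1r.
have flin : linear f.
  move=> c a b; apply: f_uniq.
  rewrite scalerDl -scalerA opprD addrACA -scalerBr; exact: Wlin.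
exists (HB.pack f (GRing.isLinear.Build _ _ _ _ f flin) : {linear V -> K^o}).
by apply: f_uniq; rewrite scale1r subrr.
Qed.

(* The ungraded tensor product of algebras: the free module on A * B, with the product
   extending (a, b) * (a', b') = (a * a', b * b') bilinearly, modulo the
   submodule of the bilinearity relations. *)
Section PreTensor.
Context (R : comNzRingType) (A B : algType R).

Definition preTensor : Type := {malg R[(A * B)%type]}.
HB.instance Definition _ := GRing.Lmodule.on preTensor.

Notation M := preTensor.
Definition pure (a : A) (b : B) : M := << (a, b) >>.

Fact preTensor_mul_subdef : {mul : M -> M -> M | forall x y, mul x y =
  malg_ext (fun u => malg_ext (fun v => pure (u.1 * v.1) (u.2 * v.2)) y : M) x}.
Proof. by eexists => x y. Qed.

Definition preTensor_mul : M -> M -> M := sval preTensor_mul_subdef.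

Lemma preTensor_mulE x y : preTensor_mul x y =
  malg_ext (fun u => malg_ext (fun v => pure (u.1 * v.1) (u.2 * v.2)) y : M) x.
Proof. exact: svalP preTensor_mul_subdef x y. Qed.

Lemma preTensor_ind (P : M -> Prop) :
  P 0 -> (forall x y : M, P x -> P y -> P (x + y)) ->
  (forall c u, P << c *g u >>) -> forall x, P x.
Proof. exact: malg_ind. Qed.

Lemma preTensor_mulUU c d u v :
  preTensor_mul << c *g u >> << d *g v >> =
  << c * d *g (u.1 * v.1, u.2 * v.2) >>.
Proof. by rewrite preTensor_mulE 2!malg_extU 2!malgZU mulr1. Qed.

Lemma preTensor_mulDl : left_distributive preTensor_mul +%R.
Proof. by move=> x y z; rewrite !preTensor_mulE linearD. Qed.

Lemma preTensor_mulZl c x y :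
  preTensor_mul (c *: x) y = c *: preTensor_mul x y.
Proof. by rewrite !preTensor_mulE linearZ. Qed.

Lemma preTensor_mul0r y : preTensor_mul 0 y = 0.
Proof. by rewrite preTensor_mulE linear0. Qed.

Lemma preTensor_mulDr : right_distributive preTensor_mul +%R.
Proof.
move=> x y z; elim/preTensor_ind: x => [|x x' IHx IHx'|c u].
- by rewrite !preTensor_mul0r addr0.
- by rewrite !preTensor_mulDl IHx IHx' addrACA.
- by rewrite !preTensor_mulE !malg_extU linearD scalerDr.
Qed.

Lemma preTensor_mulZr c x y :
  preTensor_mul x (c *: y) = c *: preTensor_mul x y.
Proof.
elim/preTensor_ind: x => [|x x' IHx IHx'|d u].
- by rewrite !preTensor_mul0r scaler0.
- by rewrite !preTensor_mulDl IHx IHx' scalerDr.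
- by rewrite !preTensor_mulE !malg_extU linearZ !scalerA mulrC.
Qed.

Lemma preTensor_mulr0 x : preTensor_mul x 0 = 0.
Proof. by have := preTensor_mulZr 0 x 0; rewrite !scale0r. Qed.

Lemma preTensor_mulA : associative preTensor_mul.
Proof.
move=> x y z.
elim/preTensor_ind: x => [|x x' IHx IHx'|c u]; first by rewrite !preTensor_mul0r.
  by rewrite !preTensor_mulDl IHx IHx'.
elim/preTensor_ind: y => [|y y' IHy IHy'|d v].
- by rewrite preTensor_mulr0 preTensor_mul0r preTensor_mulr0.
- by rewrite preTensor_mulDl !preTensor_mulDr preTensor_mulDl IHy IHy'.
elim/preTensor_ind: z => [|z z' IHz IHz'|e w]; first by rewrite !preTensor_mulr0.
  by rewrite !preTensor_mulDr IHz IHz'.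
by rewrite !preTensor_mulUU /= !mulrA.
Qed.

Lemma preTensor_mul1r : left_id (pure 1 1) preTensor_mul.
Proof.
elim/preTensor_ind=> [|x x' IHx IHx'|c [a b]]; first by rewrite preTensor_mulr0.
  by rewrite preTensor_mulDr IHx IHx'.
by rewrite preTensor_mulUU /= !mul1r.
Qed.

Lemma preTensor_mulr1 : right_id (pure 1 1) preTensor_mul.
Proof.
elim/preTensor_ind=> [|x x' IHx IHx'|c [a b]]; first by rewrite preTensor_mul0r.
  by rewrite preTensor_mulDl IHx IHx'.
by rewrite preTensor_mulUU /= !mulr1.
Qed.

Lemma preTensor_oner_neq0 : pure 1 1 != 0.
Proof. by rewrite monalgU_eq0 oner_eq0. Qed.

HB.instance Definition _ := GRing.Zmodule_isNzRing.Build preTensor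
  preTensor_mulA preTensor_mul1r preTensor_mulr1
  preTensor_mulDl preTensor_mulDr preTensor_oner_neq0.
HB.instance Definition _ := GRing.Lmodule_isLalgebra.Build R preTensor
  (fun c x y => esym (preTensor_mulZl c x y)).
HB.instance Definition _ := GRing.Lalgebra_isAlgebra.Build R preTensor
  (fun c x y => esym (preTensor_mulZr c x y)).

Inductive bilinear_relator : M -> Prop :=
| bilinear_Dl a a' b : bilinear_relator (pure (a + a') b - pure a b - pure a' b)
| bilinear_Dr a b b' : bilinear_relator (pure a (b + b') - pure a b - pure a b')
| bilinear_Zl c a b : bilinear_relator (pure (c *: a) b - c *: pure a b)
| bilinear_Zr c a b : bilinear_relator (pure a (c *: b) - c *: pure a b).

Inductive bilinear_span : M -> Prop :=
| bilinear_span_gen x : bilinear_relator x -> bilinear_span x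
| bilinear_span0 : bilinear_span 0
| bilinear_spanD x y :
    bilinear_span x -> bilinear_span y -> bilinear_span (x + y)
| bilinear_spanZ c x : bilinear_span x -> bilinear_span (c *: x).

Lemma bilinear_span_zmod : zmod_closed (fun x => `[< bilinear_span x >]).
Proof.
split=> [|x y /asboolP Sx /asboolP Sy]; apply/asboolP.
  exact: bilinear_span0.
by apply: bilinear_spanD => //; rewrite -scaleN1r; apply: bilinear_spanZ.
Qed.

Lemma pureM a b a' b' : pure a b * pure a' b' = pure (a * a') (b * b').
Proof. by rewrite [LHS]preTensor_mulUU mulr1. Qed.

Lemma malg_pure c u : << c *g u >> = c *: pure u.1 u.2.
Proof. by case: u => a b; rewrite malgZU mulr1. Qed.

Lemma bilinear_span_mull x y : bilinear_span y -> bilinear_span (x * y).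
Proof.
elim/preTensor_ind: x => [|x x' IHx IHx'|c [a b]] Sy.
- by rewrite mul0r; apply: bilinear_span0.
- by rewrite mulrDl; apply: bilinear_spanD; [apply: IHx|apply: IHx'].
rewrite malg_pure -scalerAl; apply: bilinear_spanZ => /=.
elim: Sy => {y} [y [] *||y y' _ IHy _ IHy'|d y _ IHy].
- by rewrite !mulrBr !pureM mulrDr; apply/bilinear_span_gen/bilinear_Dl.
- by rewrite !mulrBr !pureM mulrDr; apply/bilinear_span_gen/bilinear_Dr.
- rewrite mulrBr -scalerAr !pureM -scalerAr.
  exact/bilinear_span_gen/bilinear_Zl.
- rewrite mulrBr -scalerAr !pureM -scalerAr.
  exact/bilinear_span_gen/bilinear_Zr.
- by rewrite mulr0; apply: bilinear_span0.
- by rewrite mulrDr; apply: bilinear_spanD.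
- by rewrite -scalerAr; apply: bilinear_spanZ.
Qed.

Lemma bilinear_span_mulr x y : bilinear_span y -> bilinear_span (y * x).
Proof.
elim/preTensor_ind: x => [|x x' IHx IHx'|c [a b]] Sy.
- by rewrite mulr0; apply: bilinear_span0.
- by rewrite mulrDr; apply: bilinear_spanD; [apply: IHx|apply: IHx'].
rewrite malg_pure -scalerAr; apply: bilinear_spanZ => /=.
elim: Sy => {y} [y [] *||y y' _ IHy _ IHy'|d y _ IHy].
- by rewrite !mulrBl !pureM mulrDl; apply/bilinear_span_gen/bilinear_Dl.
- by rewrite !mulrBl !pureM mulrDl; apply/bilinear_span_gen/bilinear_Dr.
- rewrite mulrBl -scalerAl !pureM -scalerAl.
  exact/bilinear_span_gen/bilinear_Zl.
- rewrite mulrBl -scalerAl !pureM -scalerAl.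
  exact/bilinear_span_gen/bilinear_Zr.
- by rewrite mul0r; apply: bilinear_span0.
- by rewrite mulrDl; apply: bilinear_spanD.
- by rewrite -scalerAl; apply: bilinear_spanZ.
Qed.

End PreTensor.

Section Tensor.
Context (K : fieldType) (A B : algType K).

Lemma bilinear_span_proper : ~ bilinear_span (1 : preTensor A B).
Proof.
have [phi phi1] := linear_functional_eq1 (oner_neq0 A).
pose h (u : A * B) : B := (phi u.1 : K) *: u.2.
have hU a b : malg_ext h (pure a b) = (phi a : K) *: b.
  by rewrite malg_extU scale1r.
suff S0 x : bilinear_span x -> malg_ext h x = 0.
  move/S0=> h1; have := hU 1 1; rewrite phi1 scale1r => hu.
  by have /eqP := etrans (esym hu) h1; rewrite oner_eq0.
elim=> {x} [x []||x y _ IHx _ IHy|c x _ IHx].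
- by move=> a a' b; rewrite !linearB /= !hU linearD scalerDl /= addrAC addrK subrr.
- by move=> a b b'; rewrite !linearB /= !hU scalerDr addrAC addrK subrr.
- by move=> c a b; rewrite linearB linearZ /= !hU linearZ scalerA subrr.
- by move=> c a b; rewrite linearB linearZ /= !hU !scalerA mulrC subrr.
- exact: linear0.
- by rewrite linearD /= IHx IHy addr0.
- by rewrite linearZ /= IHx scaler0.
Qed.

Definition tensor_ideal : twoSidedIdeal (preTensor A B).
Proof.
apply: (TwoSidedIdeal (@bilinear_span_zmod K A B)).
- by move=> a x /asboolP Sx; apply/asboolP; apply: bilinear_span_mull.
- by move=> a x /asboolP Sx; apply/asboolP; apply: bilinear_span_mulr.
- by apply/negP => /asboolP; apply: bilinear_span_proper.
Defined.

Definition tensorAlg : algType K := quotAlg tensor_ideal.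

End Tensor.

(* Main.v *)
(* Write the chirality element of C(2m) as the product G of the pairwise
   commuting factors i w_(2j) w_(2j+1), each of square 1.  It satisfies G^2 = 1,
   anticommutes with every w_i of C(2m), and commutes with whatever anticommutes
   with all of them.  Multiplying a generator by G therefore turns commutation
   with C(2m) into anticommutation and back, without changing products of two
   generators: the isomorphism sends the first 2m generators w_i to w_i (x) 1
   and any other generator y to G (x) y; its inverse sends 1 (x) y to G y. *)
From HB Require Import structures.
From mathcomp Require Import all_boot all_algebra.
From mathcomp Require Import boolp reals.
From mathcomp.multinomials Require Import monalg.
From mathcomp.real_closed Require Import complex.
Require Import Defs.

Set Implicit Arguments.
Unset Strict Implicit.
Unset Printing Implicit Defensive.

Import GRing.Theory.
Local Open Scope ring_scope.

(* Terms such as [etrans (fD _ _) _] and [f_equal2 +%R _ _] replace rewriting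
   where comparing the algebraic structures of the free algebra, of the
   pretensor product or of a quotient by unification is very slow. *)

Section Quotient.
Context (R : comNzRingType) (A : algType R) (I : twoSidedIdeal A).

Fact quot_pi_is_linear : linear (@quot_pi R A I).
Proof. by move=> c x y; rewrite quot_piD -quot_piZ. Qed.
HB.instance Definition _ :=
  GRing.isLinear.Build R A (quotAlg I) _ (@quot_pi R A I) quot_pi_is_linear.

Fact quot_pi_is_monoid_morphism : monoid_morphism (@quot_pi R A I).
Proof. by split=> // x y; rewrite -quot_piM. Qed.
HB.instance Definition _ := GRing.isMonoidMorphism.Build A (quotAlg I)
  (@quot_pi R A I) quot_pi_is_monoid_morphism.

Lemma quotAlg_universal (B : algType R) (f : {lrmorphism A -> B}) :
  {in ideal_pred I, forall x, f x = 0} ->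
  exists g : {lrmorphism quotAlg I -> B}, forall x, g (quot_pi I x) = f x.
Proof.
move=> f0; pose g (u : quotAlg I) := f (quot_repr u).
have gE x : g (quot_pi I x) = f x.
  by apply/eqP; rewrite -subr_eq0 -raddfB /= f0 //; apply/quot_piP/quot_reprK.
have glin : linear g.
  move=> c u v; rewrite -[u]quot_reprK -[v]quot_reprK -linearP !gE.
  exact: linearP.
have gmul : monoid_morphism g.
  split=> [|u v]; first by rewrite -(rmorph1 (quot_pi I)) gE rmorph1.
  by rewrite -[u]quot_reprK -[v]quot_reprK -rmorphM !gE rmorphM.
by exists (HB.pack g (GRing.isLinear.Build _ _ _ _ g glin)
  (GRing.isMonoidMorphism.Build _ _ g gmul) : {lrmorphism quotAlg I -> B}).
Qed.

End Quotient.

(** * Universal property and induction principle of the free algebra *)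

Section FreeAlgebra.
Context (R : comNzRingType) (X : choiceType) (A : algType R).

Lemma freeAlg_universal (h : X -> A) :
  exists f : {lrmorphism freeAlg R X -> A}, forall x, f (free_gen R x) = h x.
Proof.
pose f : freeAlg R X -> A :=
  malg_ext (fun m : {fmonom X} => \prod_(x <- m) h x).
have fU c m : f << c *g m >> = c *: \prod_(x <- (m : {fmonom X})) h x.
  exact: malg_extU.
have flin : linear f by exact: malg_ext_is_linear.
have fD x y : f (x + y) = f x + f y by have := flin 1 x y; rewrite !scale1r.
have f0 : f 0 = 0 by apply: (addrI (f 0)); rewrite -fD !addr0.
have fmul : monoid_morphism f.
  split=> [|x y]; first by rewrite [LHS]fU fm1 big_nil scale1r.
  elim/freeAlg_ind: x => [|x x' IHx IHx'|c u]; first by rewrite mul0r f0 mul0r.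
    by rewrite mulrDl 2!fD mulrDl; exact: (f_equal2 +%R IHx IHx').
  elim/freeAlg_ind: y => [|y y' IHy IHy'|d v]; first by rewrite mulr0 f0 mulr0.
    by rewrite mulrDr 2!fD mulrDr; exact: (f_equal2 +%R IHy IHy').
  by rewrite freeAlg_mulUU !fU fmM big_cat /= -scalerAl -scalerAr scalerA.
exists (HB.pack f (GRing.isLinear.Build _ _ _ _ f flin)
  (GRing.isMonoidMorphism.Build _ _ f fmul) : {lrmorphism freeAlg R X -> A}) => x.
by rewrite [LHS]fU fmU big_seq1 scale1r.
Qed.

Lemma freeAlg_gen_ind (P : freeAlg R X -> Prop) :
  P 1 -> (forall c x y, P x -> P y -> P (c *: x + y)) ->
  (forall x y, P x -> P y -> P (x * y)) -> (forall x, P (free_gen R x)) ->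
  forall x, P x.
Proof.
move=> P1 PL PM Pgen.
have P0 : P 0 by rewrite -(addNr 1) -scaleN1r; apply: PL.
elim/freeAlg_ind=> [//|x y Px Py|c m].
  by rewrite -[x]scale1r; apply: PL.
have -> : << c *g m >> = c *: (<< m >> : freeAlg R X) + 0.
  by rewrite freeAlgZU mulr1 addr0.
apply: PL => //; case: m => s; elim: s => [|x s IHs].
  have -> // : << FMonom [::] >> = 1 :> freeAlg R X.
  by congr << _ >>; apply: val_inj; rewrite /= fm1.
have -> : << FMonom (x :: s) >> = free_gen R x * << FMonom s >>.
  by rewrite freeAlg_mulUU mulr1; congr << _ >>; apply: val_inj; rewrite /= fmM fmU.
exact: PM.
Qed.

End FreeAlgebra.

(** * Clifford-Weyl algebras presented by generators and relations *)

Section CliffordWeyl.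
Context (R : comNzRingType) (n k : nat).

(** The relations are imposed on families in an arbitrary ring, so that one record covers the
    generators, their images under morphisms and their twists by the chirality element. *)
Record cw_family (A : nzRingType) (w : 'I_n -> A) (p q : 'I_k -> A) : Prop := {
  cwf_ww i j : w i * w j + w j * w i = 2 * (i == j)%:R;
  cwf_pq i j : p i * q j - q j * p i = (i == j)%:R;
  cwf_pp i j : p i * p j = p j * p i;
  cwf_qq i j : q i * q j = q j * q i;
  cwf_wp i j : w i * p j + p j * w i = 0;
  cwf_wq i j : w i * q j + q j * w i = 0
}.

Notation F := (freeAlg R (cw_index n k)).

(** Both directions serve: from right to left, the projection shows that the generators satisfy the
    relations; from left to right, a family satisfying them gives a morphism that factors through
    the quotient. *)
Lemma cw_family_relator (A : algType R) (f : {lrmorphism F -> A}) :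
  cw_family (fun i => f (cw_omega R k i)) (fun i => f (cw_p R n i))
    (fun i => f (cw_q R n i)) <->
  forall z, cw_relator z -> f z = 0.
Proof.
have fM : {morph f : x y / x * y} by exact: rmorphM.
have fD : {morph f : x y / x + y} by exact: raddfD.
have fB : {morph f : x y / x - y} by exact: raddfB.
have fMD x y x' y' : f (x * y + x' * y') = f x * f y + f x' * f y'.
  by rewrite fD; exact: (f_equal2 +%R (fM _ _) (fM _ _)).
have fMB x y x' y' : f (x * y - x' * y') = f x * f y - f x' * f y'.
  by rewrite fB; exact: (f_equal2 (fun a b => a - b) (fM _ _) (fM _ _)).
(* The constant terms [(i == j)%:R] and, by [f2] below, [2 * (i == j)%:R] are both numerals, which a
   ring morphism preserves. *)
have fBn x y e m : e = m%:R -> f (x - e) = y <-> f x = y + m%:R.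
  move=> ->; have -> : f (x - m%:R) = f x - m%:R.
    by rewrite fB; congr (_ - _); apply: rmorph_nat.
  by split=> [<-|->]; rewrite ?subrK ?addrK.
have f2 (b : bool) : 2 * b%:R = (2 * b)%:R :> F by rewrite natrM.
split=> [[ww pq pp qq wp wq] z [] i j|f0].
- apply/(fBn _ _ _ _ (f2 _)); rewrite add0r natrM.
  by apply: etrans (fMD _ _ _ _) (ww _ _).
- by apply/fBn; rewrite ?add0r //; apply: etrans (fMB _ _ _ _) (pq _ _).
- by apply: etrans (fMB _ _ _ _) _; rewrite pp subrr.
- by apply: etrans (fMB _ _ _ _) _; rewrite qq subrr.
- exact: etrans (fMD _ _ _ _) (wp _ _).
- exact: etrans (fMD _ _ _ _) (wq _ _).
split=> i j.
- have /(fBn _ _ _ _ (f2 _)) := f0 _ (cw_ww R k i j).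
  by rewrite add0r natrM; apply: etrans (esym (fMD _ _ _ _)).
- have /fBn-/(_ _ erefl) := f0 _ (cw_pq R n i j).
  by rewrite add0r; apply: etrans (esym (fMB _ _ _ _)).
- apply/eqP; rewrite -subr_eq0; apply/eqP.
  exact: etrans (esym (fMB _ _ _ _)) (f0 _ (cw_pp R n i j)).
- apply/eqP; rewrite -subr_eq0; apply/eqP.
  exact: etrans (esym (fMB _ _ _ _)) (f0 _ (cw_qq R n i j)).
- exact: etrans (esym (fMD _ _ _ _)) (f0 _ (cw_wp R i j)).
- exact: etrans (esym (fMD _ _ _ _)) (f0 _ (cw_wq R i j)).
Qed.

Notation CW := (cliffordWeyl R n k).
Let pi : {lrmorphism F -> CW} := quot_pi (ideal_gen_by (@cw_proper R n k)).

Definition gen_omega (i : 'I_n) : CW := quot_pi _ (cw_omega R k i).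
Definition gen_p (i : 'I_k) : CW := quot_pi _ (cw_p R n i).
Definition gen_q (i : 'I_k) : CW := quot_pi _ (cw_q R n i).

Lemma cliffordWeyl_family : cw_family gen_omega gen_p gen_q.
Proof.
apply/(cw_family_relator pi) => z Sz.
rewrite -[RHS](raddf0 pi); apply/quot_piP; rewrite subr0.
exact/asboolP/in_ideal_gen.
Qed.

Lemma cliffordWeyl_universal (A : algType R) w p q :
  @cw_family A w p q -> exists f : {lrmorphism CW -> A},
  [/\ forall i, f (gen_omega i) = w i, forall i, f (gen_p i) = p i
    & forall i, f (gen_q i) = q i].
Proof.
move=> fam.
pose h (x : cw_index n k) : A :=
  match x with inl i => w i | inr (inl i) => p i | inr (inr i) => q i end.
have [f fE] := freeAlg_universal h.
have fw : (fun i => f (cw_omega R k i)) = w by apply: funext => i; apply: fE.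
have fp : (fun i => f (cw_p R n i)) = p by apply: funext => i; apply: fE.
have fq : (fun i => f (cw_q R n i)) = q by apply: funext => i; apply: fE.
have rel0 : forall z, cw_relator z -> f z = 0.
  by apply/cw_family_relator; rewrite fw fp fq.
have fD : {morph f : x y / x + y} by exact: raddfD.
have fM : {morph f : x y / x * y} by exact: rmorphM.
have f0 : {in ideal_pred (ideal_gen_by (@cw_proper R n k)), forall x, f x = 0}.
  move=> x /asboolP; elim=> {x} [x /rel0//||x y _ IHx _ IHy|a x _ IHx|a x _ IHx].
  - exact: raddf0.
  - by rewrite fD; apply: etrans (f_equal2 +%R IHx IHy) (addr0 _).
  - by rewrite fM; apply: etrans (congr1 _ IHx) (mulr0 _).
  - by rewrite fM; apply: etrans (congr1 ( *%R^~ _) IHx) (mul0r _).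
have [g gE] := quotAlg_universal f0.
by exists g; split=> i; rewrite [LHS]gE; apply: fE.
Qed.

Lemma cliffordWeyl_ind (P : CW -> Prop) :
  P 1 -> (forall c u v, P u -> P v -> P (c *: u + v)) ->
  (forall u v, P u -> P v -> P (u * v)) ->
  (forall i, P (gen_omega i)) -> (forall i, P (gen_p i)) ->
  (forall i, P (gen_q i)) -> forall u, P u.
Proof.
move=> P1 PL PM Pw Pp Pq u; rewrite -[u]quot_reprK.
elim/freeAlg_gen_ind: (quot_repr u) => [|c x y Px Py|x y Px Py|].
- by rewrite -(rmorph1 pi) in P1.
- by rewrite quot_piD -quot_piZ; exact: (PL c (quot_pi _ x) (quot_pi _ y)).
- by rewrite -quot_piM; exact: (PM (quot_pi _ x) (quot_pi _ y)).
- by case=> [i|[i|i]]; [exact: Pw|exact: Pp|exact: Pq].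
Qed.

Lemma cliffordWeyl_hom_ext (A : algType R) (f g : {lrmorphism CW -> A}) :
  (forall i, f (gen_omega i) = g (gen_omega i)) ->
  (forall i, f (gen_p i) = g (gen_p i)) ->
  (forall i, f (gen_q i) = g (gen_q i)) -> f =1 g.
Proof.
have hP (h : {lrmorphism CW -> A}) c u v : h (c *: u + v) = c *: h u + h v.
  exact: linearP.
have hM (h : {lrmorphism CW -> A}) u v : h (u * v) = h u * h v.
  exact: rmorphM.
move=> fgw fgp fgq; elim/cliffordWeyl_ind => [|c u v fgu fgv|u v fgu fgv| | |] //.
- by rewrite !rmorph1.
- by rewrite !hP fgu fgv.
- by rewrite !hM fgu fgv.
Qed.

(** The [u] for which [f u] commutes with [a] form a subalgebra, so the generators decide. *)
Lemma cliffordWeyl_centralizer (A : algType R) (f : {lrmorphism CW -> A}) a :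
  (forall i, a * f (gen_omega i) = f (gen_omega i) * a) ->
  (forall i, a * f (gen_p i) = f (gen_p i) * a) ->
  (forall i, a * f (gen_q i) = f (gen_q i) * a) ->
  forall u, a * f u = f u * a.
Proof.
have fP c u v : f (c *: u + v) = c *: f u + f v by exact: linearP.
have fM u v : f (u * v) = f u * f v by exact: rmorphM.
move=> aw ap aq; elim/cliffordWeyl_ind => [|c u v au av|u v au av| | |] //.
- by rewrite rmorph1 mulr1 mul1r.
- by rewrite fP mulrDl mulrDr -scalerAl -scalerAr au av.
- by rewrite fM mulrA au -!mulrA av.
Qed.

End CliffordWeyl.

(** * Universal property of the tensor product of algebras *)

Section Tensor.
Context (K : fieldType) (A B : algType K).
Notation T := (tensorAlg A B).

Definition tens (a : A) (b : B) : T := quot_pi (tensor_ideal A B) (pure a b).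

Lemma tensM a b a' b' : tens a b * tens a' b' = tens (a * a') (b * b').
Proof. by rewrite /tens -pureM rmorphM. Qed.

Lemma tensPl b c a a' : tens (c *: a + a') b = c *: tens a b + tens a' b.
Proof.
transitivity (tens (c *: a) b + tens a' b).
  rewrite -[RHS]quot_piD; apply/quot_piP; rewrite opprD addrA.
  exact/asboolP/bilinear_span_gen/bilinear_Dl.
congr (_ + _); apply: etrans (esym (quot_piZ _ _ _)); apply/quot_piP.
exact/asboolP/bilinear_span_gen/bilinear_Zl.
Qed.

Lemma tensPr a c b b' : tens a (c *: b + b') = c *: tens a b + tens a b'.
Proof.
transitivity (tens a (c *: b) + tens a b').
  rewrite -[RHS]quot_piD; apply/quot_piP; rewrite opprD addrA.
  exact/asboolP/bilinear_span_gen/bilinear_Dr.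
congr (_ + _); apply: etrans (esym (quot_piZ _ _ _)); apply/quot_piP.
exact/asboolP/bilinear_span_gen/bilinear_Zr.
Qed.

Definition tensl a := tens a 1.
Definition tensr b := tens 1 b.

HB.instance Definition _ := GRing.isLinear.Build K A T _ tensl (tensPl 1).
HB.instance Definition _ := GRing.isLinear.Build K B T _ tensr (tensPr 1).

Fact tensl_is_monoid_morphism : monoid_morphism tensl.
Proof.
split=> [|a a']; last by rewrite [RHS]tensM mulr1.
exact: (rmorph1 (quot_pi (tensor_ideal A B))). Qed.
HB.instance Definition _ :=
  GRing.isMonoidMorphism.Build A T tensl tensl_is_monoid_morphism.

Fact tensr_is_monoid_morphism : monoid_morphism tensr.
Proof.
split=> [|b b']; last by rewrite [RHS]tensM mulr1.
by rewrite /tensr /tens -[RHS](rmorph1 (quot_pi (tensor_ideal A B))). Qed.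
HB.instance Definition _ :=
  GRing.isMonoidMorphism.Build B T tensr tensr_is_monoid_morphism.

Lemma tens_lr a b : tens a b = tensl a * tensr b.
Proof. by rewrite tensM mulr1 mul1r. Qed.

Lemma tensC a b : tensl a * tensr b = tensr b * tensl a.
Proof. by rewrite !tensM !mulr1 !mul1r. Qed.

(** Commutation of the two images makes the bilinear extension multiplicative: it lets [g b] move
    past [f a'] in [f a * g b * (f a' * g b')]. *)
Lemma tensorAlg_universal (C : algType K)
    (f : {lrmorphism A -> C}) (g : {lrmorphism B -> C}) :
  (forall a b, f a * g b = g b * f a) ->
  exists h : {lrmorphism T -> C}, forall a b, h (tens a b) = f a * g b.
Proof.
move=> fgC.
pose h : preTensor A B -> C := malg_ext (fun u => f u.1 * g u.2).
have hU c u : h << c *g u >> = c *: (f u.1 * g u.2) by exact: malg_extU.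
have hlin : linear h by exact: malg_ext_is_linear.
have hD x y : h (x + y) = h x + h y by have := hlin 1 x y; rewrite !scale1r.
have h0 : h 0 = 0 by apply: (addrI (h 0)); rewrite -hD !addr0.
have hmul : monoid_morphism h.
  split=> [|x y]; first by rewrite [LHS]hU !rmorph1 mulr1 scale1r.
  elim/preTensor_ind: x => [|x x' IHx IHx'|c u]; first by rewrite mul0r h0 mul0r.
    by rewrite mulrDl 2!hD mulrDl; exact: (f_equal2 +%R IHx IHx').
  elim/preTensor_ind: y => [|y y' IHy IHy'|d v]; first by rewrite mulr0 h0 mulr0.
    by rewrite mulrDr 2!hD mulrDr; exact: (f_equal2 +%R IHy IHy').
  rewrite [X in h X]preTensor_mulUU !hU /= !rmorphM -scalerAl -scalerAr scalerA.
  by congr (_ *: _); rewrite -!mulrA; congr (_ * _); rewrite !mulrA fgC.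
pose H : {lrmorphism preTensor A B -> C} := HB.pack h
  (GRing.isLinear.Build _ _ _ _ h hlin) (GRing.isMonoidMorphism.Build _ _ h hmul).
have hpure a b : h (pure a b) = f a * g b by rewrite hU scale1r.
have hZ c x : h (c *: x) = c *: h x by have := hlin c x 0; rewrite h0 !addr0.
have hB x y : h (x - y) = h x - h y by exact: (raddfB H).
have hDrel a1 b1 a2 b2 a3 b3 : h (pure a1 b1 - pure a2 b2 - pure a3 b3) =
    f a1 * g b1 - f a2 * g b2 - f a3 * g b3.
  by rewrite -!hpure; apply: etrans (hB _ _) _; congr (_ - _); apply: hB.
have hZrel a1 b1 c a2 b2 : h (pure a1 b1 - c *: pure a2 b2) =
    f a1 * g b1 - c *: (f a2 * g b2).
  by rewrite -!hpure -hZ; apply: hB.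
(* The ideal is the linear span of the bilinearity relators, so besides linearity only the four
   kinds of relator have to be checked. *)
have H0 : {in ideal_pred (tensor_ideal A B), forall x, H x = 0}.
  move=> x /asboolP; rewrite -/(h x).
  elim=> {x} [x [] *||x y _ IHx _ IHy|c x _ IHx].
  - by apply: etrans (hDrel _ _ _ _ _ _) _; rewrite raddfD mulrDl addrAC addrK subrr.
  - by apply: etrans (hDrel _ _ _ _ _ _) _; rewrite raddfD mulrDr addrAC addrK subrr.
  - by apply: etrans (hZrel _ _ _ _ _) _; rewrite linearZ /= -scalerAl subrr.
  - by apply: etrans (hZrel _ _ _ _ _) _; rewrite linearZ /= -scalerAr subrr.
  - exact: h0.
  - by apply: etrans (hD _ _) _; apply: etrans (f_equal2 +%R IHx IHy) (addr0 _).
  - by apply: etrans (hZ _ _) _; apply: etrans (congr1 _ IHx) (scaler0 _ _).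
have [F FE] := quotAlg_universal H0.
by exists F => a b; rewrite [LHS]FE; apply: hpure.
Qed.

(** The products [tensl a * tensr b] span the tensor product, and morphisms are multiplicative on
    them. *)
Lemma tensorAlg_hom_ext (C : algType K) (f g : {lrmorphism T -> C}) :
  (forall a, f (tensl a) = g (tensl a)) ->
  (forall b, f (tensr b) = g (tensr b)) -> f =1 g.
Proof.
have hZM (h : {lrmorphism T -> C}) c x y :
  h (c *: (x * y)) = c *: (h x * h y) by rewrite linearZ rmorphM.
move=> fgl fgr u; rewrite -[u]quot_reprK.
elim/preTensor_ind: (quot_repr u) => [|x y IHx IHy|c v].
- exact: etrans (raddf0 (f \o quot_pi _)) (esym (raddf0 (g \o quot_pi _))).
- rewrite quot_piD; apply: etrans (raddfD f _ _) _.
  exact: etrans (f_equal2 +%R IHx IHy) (esym (raddfD g _ _)).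
rewrite malg_pure.
have -> : quot_pi _ (c *: pure v.1 v.2) = c *: (tensl v.1 * tensr v.2) :> T.
  by rewrite -tens_lr; apply: esym (quot_piZ _ _ _).
by rewrite !hZM fgl fgr.
Qed.

End Tensor.

(** * The chirality element of a sequence of anticommuting square roots of 1 *)

Section NatChirality.
Context (K : fieldType) (iu : K) (iu2 : iu ^+ 2 = -1) (A : algType K).
Implicit Types (m : nat) (x : nat -> A) (z : A).

(** The sequence is indexed by [nat], with hypotheses only below [2 * m], so that induction on [m]
    needs no change of index type. *)
Definition nat_chirality m x : A :=
  \prod_(j < m) (iu *: (x (2 * j)%N * x (2 * j).+1)).

Lemma nat_chiralityS m x : nat_chirality m.+1 x =
  nat_chirality m x * (iu *: (x (2 * m)%N * x (2 * m).+1)).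
Proof. by rewrite /nat_chirality big_ord_recr. Qed.

(** Each factor contains two elements anticommuting with [z], and the two signs cancel. *)
Lemma nat_chirality_comm m x z :
  (forall i, (i < 2 * m)%N -> z * x i = - (x i * z)) ->
  z * nat_chirality m x = nat_chirality m x * z.
Proof.
elim: m => [|m IHm] zx; first by rewrite /nat_chirality big_ord0 mulr1 mul1r.
rewrite mulnS in zx.
rewrite nat_chiralityS mulrA IHm => [|i im]; last by apply: zx; rewrite ltn_addl.
rewrite -!mulrA; congr (_ * _); rewrite -scalerAr -scalerAl; congr (_ *: _).
by rewrite mulrA zx // mulNr -mulrA zx // mulrN opprK mulrA.
Qed.

(** By induction on [m]: an element of the last pair commutes with the earlier factors and
    anticommutes with its own; an earlier element anticommutes with the earlier factors by induction
    and commutes with the last one. *)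
Lemma nat_chirality_anticomm m x i :
  (forall i, (i < 2 * m)%N -> x i * x i = 1) ->
  (forall i j, (i < 2 * m)%N -> (j < 2 * m)%N -> i != j ->
    x i * x j = - (x j * x i)) ->
  (i < 2 * m)%N -> x i * nat_chirality m x = - (nat_chirality m x * x i).
Proof.
elim: m => [|m IHm] // x2 xac; rewrite mulnS in x2 xac *.
have bm0 : (2 * m < 2 + 2 * m)%N by [].
have bm1 : ((2 * m).+1 < 2 + 2 * m)%N by [].
have lt2 j : (j < 2 * m)%N -> (j < 2 + 2 * m)%N by move=> jm; rewrite ltn_addl.
have vu : x (2 * m).+1 * x (2 * m)%N = - (x (2 * m)%N * x (2 * m).+1).
  by apply: xac; rewrite ?neq_ltn ?leqnn ?orbT.
(* The bound on [i] is split into three cases, in this order: [i = (2 * m).+1], [i = 2 * m], and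
   [i < 2 * m]. *)
rewrite nat_chiralityS mulrA !ltnS leq_eqVlt ltnS leq_eqVlt.
have chiC j : (2 * m <= j < 2 + 2 * m)%N ->
    x j * nat_chirality m x = nat_chirality m x * x j.
  case/andP=> mj j2; apply: nat_chirality_comm => l lm.
  by apply: xac => //; [exact: lt2|rewrite gtn_eqF // (leq_trans lm)].
case/or3P=> [/eqP->|/eqP->|im].
- rewrite chiC ?leqnSn ?bm1 // -!mulrA -mulrN; congr (_ * _).
  rewrite -scalerAr -scalerAl -scalerN; congr (_ *: _).
  by rewrite mulrA vu mulNr.
- rewrite chiC ?leqnn // -!mulrA -mulrN; congr (_ * _).
  rewrite -scalerAr -scalerAl -scalerN; congr (_ *: _).
  by rewrite -mulrA vu mulrN opprK.
- rewrite IHm //; first 1 last.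
  + by move=> j jm; apply: x2; apply: lt2.
  + by move=> j l jm lm; apply: xac; apply: lt2.
  rewrite mulNr -!mulrA; congr (- (_ * _)).
  rewrite -scalerAr -scalerAl; congr (_ *: _).
  have iw : x i * x (2 * m)%N = - (x (2 * m)%N * x i).
    by apply: xac => //; [exact: lt2|rewrite ltn_eqF].
  have iv : x i * x (2 * m).+1 = - (x (2 * m).+1 * x i).
    by apply: xac => //; [exact: lt2|rewrite ltn_eqF // leqW].
  by rewrite mulrA iw mulNr -mulrA iv mulrN opprK mulrA.
Qed.

(** The last factor [g] commutes with the earlier ones, so the square is the product of the squares.
    With [u], [v] the last pair, the square of [g] is [- (u * v * u * v) = u * u * v * v = 1]. *)
Lemma nat_chirality_sqr m x :
  (forall i, (i < 2 * m)%N -> x i * x i = 1) ->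
  (forall i j, (i < 2 * m)%N -> (j < 2 * m)%N -> i != j ->
    x i * x j = - (x j * x i)) ->
  nat_chirality m x * nat_chirality m x = 1.
Proof.
elim: m => [|m IHm] x2 xac; first by rewrite /nat_chirality big_ord0 mulr1.
rewrite mulnS in x2 xac.
have bm0 : (2 * m < 2 + 2 * m)%N by [].
have bm1 : ((2 * m).+1 < 2 + 2 * m)%N by [].
have lt2 j : (j < 2 * m)%N -> (j < 2 + 2 * m)%N by move=> jm; rewrite ltn_addl.
have chiC j : (2 * m <= j < 2 + 2 * m)%N ->
    x j * nat_chirality m x = nat_chirality m x * x j.
  case/andP=> mj j2; apply: nat_chirality_comm => l lm.
  by apply: xac => //; [exact: lt2|rewrite gtn_eqF // (leq_trans lm)].
have uC := chiC (2 * m)%N; have vC := chiC (2 * m).+1.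
have vu : x (2 * m).+1 * x (2 * m)%N = - (x (2 * m)%N * x (2 * m).+1).
  by apply: xac; rewrite ?neq_ltn ?leqnn ?orbT.
rewrite nat_chiralityS; set g := iu *: _.
have gC : g * nat_chirality m x = nat_chirality m x * g.
  rewrite /g -scalerAl -scalerAr; congr (_ *: _).
  by rewrite -mulrA vC ?leqnSn ?bm1 // !mulrA uC ?leqnn.
rewrite mulrA -[_ * g * _]mulrA gC mulrA IHm => [|i im|i j im jm]; last first.
- by apply: xac; apply: lt2.
- by apply: x2; apply: lt2.
rewrite mul1r /g -scalerAl -scalerAr scalerA -expr2 iu2 scaleN1r.
rewrite -mulrA [x (2 * m).+1 * _]mulrA vu.
by rewrite !mulNr mulrN opprK -mulrA x2 // mulr1 x2.
Qed.

End NatChirality.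

Lemma rmorph_nat_chirality (K : fieldType) (iu : K) (A B : algType K)
    (f : {lrmorphism A -> B}) m x :
  f (nat_chirality iu m x) = nat_chirality iu m (f \o x).
Proof.
have fZM c a b : f (c *: (a * b)) = c *: (f a * f b).
  by rewrite linearZ rmorphM.
by rewrite [LHS]rmorph_prod; apply: eq_bigr => j _; apply: fZM.
Qed.

(** * Twisting families of generators by the chirality element *)

Section Twist.
Context (K : fieldType) (iu : K) (iu2 : iu ^+ 2 = -1) (two : 2 != 0 :> K).

Definition clifford_family m (A : nzRingType) (x : 'I_m -> A) :=
  forall i j, x i * x j + x j * x i = 2 * (i == j)%:R.

Lemma cw_family0 m (A : nzRingType) (x : 'I_m -> A) (p q : 'I_0 -> A) :
  clifford_family x -> cw_family x p q.
Proof. by move=> xx; split=> [||||i|i] => // -[]. Qed.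

(* [insub j] is [None] outside the range of [x], where the family takes the
   value [0], but only indices below [2 * m] are read. *)
Definition chirality m (A : algType K) (x : 'I_(2 * m) -> A) : A :=
  nat_chirality iu m (fun j => oapp x 0 (insub j)).

Lemma rmorph_chirality m (A B : algType K) (f : {lrmorphism A -> B})
    (x : 'I_(2 * m) -> A) : f (chirality x) = chirality (f \o x).
Proof.
rewrite rmorph_nat_chirality; congr nat_chirality; apply: funext => j /=.
by case: insub => //=; rewrite raddf0.
Qed.

Section Chirality.
Context (m : nat) (A : algType K) (x : 'I_(2 * m) -> A).
Hypothesis xx : clifford_family x.

(** The Clifford relation at [i = j] says that twice the square is 2, and 2 can be cancelled. *)
Lemma clifford_sqr i : x i * x i = 1.
Proof.
apply: (scalerI two); rewrite !scaler_nat mulr2n xx eqxx mulr1.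
by rewrite -scaler_nat scaler_nat.
Qed.

Lemma clifford_anticomm i j : i != j -> x i * x j = - (x j * x i).
Proof.
by move=> /negbTE ij; apply/eqP; rewrite -addr_eq0 xx ij mulr0.
Qed.

Let y (j : nat) : A := oapp x 0 (insub j).
Let y2 i : (i < 2 * m)%N -> y i * y i = 1.
Proof. by move=> im; rewrite /y insubT /= clifford_sqr. Qed.
Let yac i j : (i < 2 * m)%N -> (j < 2 * m)%N -> i != j ->
  y i * y j = - (y j * y i).
Proof. by move=> im jm ij; rewrite /y !insubT /= clifford_anticomm. Qed.

Lemma chirality_sqr : chirality x * chirality x = 1.
Proof. exact: nat_chirality_sqr. Qed.

Lemma chiralityK a : chirality x * (chirality x * a) = a.
Proof. by rewrite mulrA chirality_sqr mul1r. Qed.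

Lemma chirality_anticomm i : x i * chirality x = - (chirality x * x i).
Proof.
have -> : x i = y i by rewrite /y valK.
exact: nat_chirality_anticomm.
Qed.

Lemma chirality_comm z : (forall i, z * x i = - (x i * z)) ->
  z * chirality x = chirality x * z.
Proof.
move=> zx; apply: nat_chirality_comm => i im.
by rewrite insubT /= zx.
Qed.

(** The two copies of the chirality element meet and cancel. Apart from constants, the defining
    relations involve only products of two generators, so they survive the twist. *)
Lemma chirality_twistM a b : a * chirality x = chirality x * a ->
  (chirality x * a) * (chirality x * b) = a * b.
Proof.
by move=> aC; rewrite -aC mulrA -[a * _ * _]mulrA chirality_sqr mulr1.
Qed.

(** The sign comes from moving [x i] past the chirality element. The conclusion is a vanishing sum
    because the mixed relations fed to [cw_family_cat] have that form. *)
Lemma chirality_twist_anticomm i a : x i * a = a * x i ->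
  x i * (chirality x * a) + (chirality x * a) * x i = 0.
Proof.
by move=> xa; rewrite mulrA chirality_anticomm mulNr -(mulrA _ (x i)) xa mulrA
  addNr.
Qed.

(** Here the sign from the chirality element cancels the sign from [a]; this is the direction used
    for the inverse map. *)
Lemma chirality_twist_comm i a : x i * a = - (a * x i) ->
  x i * (chirality x * a) = (chirality x * a) * x i.
Proof.
by move=> xa; rewrite mulrA chirality_anticomm mulNr -(mulrA _ (x i)) xa mulrN
  opprK mulrA.
Qed.

End Chirality.

Definition cat_family m n (A : Type) (x : 'I_m -> A) (w : 'I_n -> A)
    (i : 'I_(m + n)) : A :=
  match fintype.split i with inl i => x i | inr j => w j end.

Lemma cat_family_lshift m n (A : Type) (x : 'I_m -> A) (w : 'I_n -> A) i :
  cat_family x w (lshift n i) = x i.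
Proof. by rewrite /cat_family (unsplitK (inl i)). Qed.

Lemma cat_family_rshift m n (A : Type) (x : 'I_m -> A) (w : 'I_n -> A) j :
  cat_family x w (rshift m j) = w j.
Proof. by rewrite /cat_family (unsplitK (inr j)). Qed.

Section TwistFamily.
Context (m n k : nat) (A : algType K) (x : 'I_(2 * m) -> A).
Context (w : 'I_n -> A) (p q : 'I_k -> A).
Hypothesis xx : clifford_family x.

Lemma cw_family_twist : cw_family w p q ->
  (forall j, w j * chirality x = chirality x * w j) ->
  (forall j, p j * chirality x = chirality x * p j) ->
  (forall j, q j * chirality x = chirality x * q j) ->
  cw_family (fun j => chirality x * w j) (fun j => chirality x * p j)
    (fun j => chirality x * q j).
Proof.
case=> ww pq pp qq wp wq wC pC qC.
by split=> i j; rewrite !chirality_twistM.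
Qed.

Lemma cw_family_cat : cw_family w p q ->
  (forall i j, x i * w j + w j * x i = 0) ->
  (forall i j, x i * p j + p j * x i = 0) ->
  (forall i j, x i * q j + q j * x i = 0) ->
  cw_family (cat_family x w) p q.
Proof.
rewrite /cat_family.
case=> ww pq pp qq wp wq xw xp xq; split=> // i j.
(* Comparing the images of [i] and [j] under [split] makes the Kronecker delta compute in each of
   the four cases. *)
- rewrite -(inj_eq (can_inj (@splitK _ _))).
  case: fintype.splitP => i' _; case: fintype.splitP => j' _ //=.
  + by rewrite xw mulr0.
  + by rewrite addrC xw mulr0.
- by case: fintype.splitP.
- by case: fintype.splitP.
Qed.

End TwistFamily.

Section UntwistFamily.
Context (m n k : nat) (A : algType K) (w : 'I_(2 * m + n) -> A).
Context (p q : 'I_k -> A).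
Hypothesis fam : cw_family w p q.
Let y i := w (lshift n i).
Let v j := w (rshift (2 * m) j).

Lemma clifford_family_lshift : clifford_family y.
Proof. by move=> i j; rewrite (cwf_ww fam) (inj_eq (@lshift_inj _ _)). Qed.

Let vfam : cw_family v p q.
Proof.
case: fam => ww pq pp qq wp wq; split=> // i j; rewrite ?wp ?wq //.
by rewrite ww (inj_eq (@rshift_inj _ _)).
Qed.

Let vy j i : v j * y i = - (y i * v j).
Proof. by apply/eqP; rewrite -addr_eq0 (cwf_ww fam) eq_rlshift mulr0. Qed.

Let py j i : p j * y i = - (y i * p j).
Proof. by apply/eqP; rewrite -addr_eq0 addrC (cwf_wp fam). Qed.

Let qy j i : q j * y i = - (y i * q j).
Proof. by apply/eqP; rewrite -addr_eq0 addrC (cwf_wq fam). Qed.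

(** The remaining generators anticommute with every [y i], hence commute with the chirality element,
    a product of an even number of them; the twist therefore applies. *)
Lemma cw_family_untwist : cw_family (fun j => chirality y * v j)
  (fun j => chirality y * p j) (fun j => chirality y * q j).
Proof.
apply: cw_family_twist clifford_family_lshift vfam _ _ _ => j;
  exact: chirality_comm.
Qed.

(** This and its analogues for [p] and [q] provide the commuting images required by
    [tensorAlg_universal]. *)
Lemma untwist_comm_omega i j : y i * (chirality y * v j) = chirality y * v j * y i.
Proof.
by apply: (chirality_twist_comm clifford_family_lshift); rewrite vy opprK.
Qed.

Lemma untwist_comm_p i j : y i * (chirality y * p j) = chirality y * p j * y i.
Proof.
by apply: (chirality_twist_comm clifford_family_lshift); rewrite py opprK.
Qed.

Lemma untwist_comm_q i j : y i * (chirality y * q j) = chirality y * q j * y i.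
Proof.
by apply: (chirality_twist_comm clifford_family_lshift); rewrite qy opprK.
Qed.

End UntwistFamily.
End Twist.

(** * The isomorphism and its inverse *)

Lemma rmorph_cw_family (R : comNzRingType) n k (A B : algType R)
    (f : {lrmorphism A -> B}) (w : 'I_n -> A) (p q : 'I_k -> A) :
  cw_family w p q -> cw_family (f \o w) (f \o p) (f \o q).
Proof.
case=> ww pq pp qq wp wq; split=> i j /=; rewrite -!rmorphM.
- by rewrite -raddfD ww -!natrM; apply: rmorph_nat.
- by rewrite -raddfB pq; apply: rmorph_nat.
- by rewrite pp.
- by rewrite qq.
- by rewrite -raddfD wp raddf0.
- by rewrite -raddfD wq raddf0.
Qed.

(** The square root of -1 makes the factors of the chirality element square to 1, and [2 != 0] makes
    the Clifford generators themselves square to 1. *)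
Lemma cliffordWeyl_tensor (K : fieldType) (iu : K) (m n k : nat) :
  iu ^+ 2 = -1 -> 2 != 0 :> K ->
  exists f : {lrmorphism cliffordWeyl K (2 * m + n) k ->
      tensorAlg (clifford K (2 * m)) (cliffordWeyl K n k)}, bijective f.
Proof.
move=> iu2 two; rewrite /clifford.
set C := cliffordWeyl K (2 * m) 0; set W := cliffordWeyl K n k.
set CW := cliffordWeyl K (2 * m + n) k; pose T := tensorAlg C W.
pose tl : {lrmorphism C -> T} := @tensl K C W.
pose tr : {lrmorphism W -> T} := @tensr K C W.
have tC a b : tl a * tr b = tr b * tl a by exact: tensC.
pose x := @gen_omega K (2 * m) 0.
pose w := @gen_omega K n k; pose p := @gen_p K n k; pose q := @gen_q K n k.
pose W1 := @gen_omega K (2 * m + n) k.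
pose P1 := @gen_p K (2 * m + n) k; pose Q1 := @gen_q K (2 * m + n) k.
have Wfam : cw_family w p q := cliffordWeyl_family K n k.
have Cfam := cliffordWeyl_family K (2 * m) 0.
have fam1 : cw_family W1 P1 Q1 :=
  cliffordWeyl_family K (2 * m + n) k.
have txx : clifford_family (tl \o x) := cwf_ww (rmorph_cw_family tl Cfam).
have chiT : chirality iu (tl \o x) = tl (chirality iu x).
  by rewrite rmorph_chirality.
have tfam := rmorph_cw_family tr Wfam.
(* The chirality element lies in the left tensor factor, so it commutes with the right one. *)
have chiC b : tr b * chirality iu (tl \o x) = chirality iu (tl \o x) * tr b.
  by rewrite chiT; apply/esym/tC.
have [f [fw fp fq]] := cliffordWeyl_universal (cw_family_cat txx
  (cw_family_twist iu2 two txx tfam (fun j => chiC (w j)) (fun j => chiC (p j))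
    (fun j => chiC (q j)))
  (fun i j => chirality_twist_anticomm iu two txx (tC (x i) (w j)))
  (fun i j => chirality_twist_anticomm iu two txx (tC (x i) (p j)))
  (fun i j => chirality_twist_anticomm iu two txx (tC (x i) (q j)))).
pose y i := W1 (lshift n i); pose v j := W1 (rshift (2 * m) j).
have yy : clifford_family y := clifford_family_lshift fam1.
(* The inverse is assembled from [g1] on the left factor and [g2] on the right one. The constant
   families 0 are indexed by ['I_0] and only fill the places of [p] and [q]. *)
have [g1 [g1x _ _]] := cliffordWeyl_universal
  (cw_family0 (fun=> 0) (fun=> 0) yy).
have [g2 [g2w g2p g2q]] := cliffordWeyl_universal
  (cw_family_untwist iu2 two fam1).
have g1y : g1 \o x = y by apply: funext.
have g1C z : (forall i, y i * z = z * y i) -> forall a, g1 a * z = z * g1 a.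
  move=> zy a; apply/esym; apply: cliffordWeyl_centralizer => [i|[]//|[]//].
  by rewrite g1x; apply/esym/zy.
(* The centralizer argument is applied on each side: here for the generators under [g2], and inside
   [g1C] for those under [g1]. *)
have g12 a b : g1 a * g2 b = g2 b * g1 a.
  apply: (cliffordWeyl_centralizer (f := g2)) => j;
    [rewrite g2w|rewrite g2p|rewrite g2q]; apply: g1C => i.
  - exact: (untwist_comm_omega iu two fam1).
  - exact: (untwist_comm_p iu two fam1).
  - exact: (untwist_comm_q iu two fam1).
have ord0_elim (i : 'I_0) (P : Prop) : P by case: i.
have [g gE] := tensorAlg_universal g12.
have gl a : g (tl a) = g1 a by rewrite [LHS]gE rmorph1 mulr1.
have gr b : g (tr b) = g2 b by rewrite [LHS]gE rmorph1 mul1r.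
have gchiT : g (chirality iu (tl \o x)) = chirality iu y.
  rewrite chiT; apply: etrans (gl _) _.
  by apply: etrans (rmorph_chirality iu g1 x) _; rewrite g1y.
have gchi b : g (chirality iu (tl \o x) * tr b) = chirality iu y * g2 b.
  by apply: etrans (rmorphM g _ _) _; exact: f_equal2 gchiT (gr b).
have fy i : f (y i) = tl (x i).
  exact: etrans (fw _) (cat_family_lshift _ _ _).
have fv j : f (v j) = chirality iu (tl \o x) * tr (w j).
  exact: etrans (fw _) (cat_family_rshift _ _ _).
have fchi : f (chirality iu y) = chirality iu (tl \o x).
  apply: etrans (rmorph_chirality iu f y) _.
  by congr chirality; apply: funext.
(* [f] carries one chirality element to the other, so the one in [f u] cancels against the image of
   the one multiplying [u]. *)
have f_twist u b :
    f u = chirality iu (tl \o x) * tr b -> f (chirality iu y * u) = tr b.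
  move=> fu; apply: etrans (rmorphM f _ _) _.
  by apply: etrans (f_equal2 *%R fchi fu) _; apply: chiralityK.
exists f; exists g.
(* Both composites are compared with the identity on generators. The first [2 * m] return unchanged;
   on the others the twists by [f] and by [g] cancel, the chirality element having square 1. *)
- apply: (@cliffordWeyl_hom_ext _ _ _ _ (g \o f) idfun) => i /=.
  + rewrite -(splitK i); case: (fintype.split i) => j.
    * by rewrite [f _]fy gl.
    * by rewrite [f _]fv gchi g2w (chiralityK iu2 two yy).
  + by rewrite fp gchi g2p (chiralityK iu2 two yy).
  + by rewrite fq gchi g2q (chiralityK iu2 two yy).
- apply: (@tensorAlg_hom_ext _ _ _ _ (f \o g) idfun) => [a|b] /=.
  + rewrite [g _]gl.
    apply: (@cliffordWeyl_hom_ext _ _ _ _ (f \o g1) tl) => i.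
    * exact: etrans (congr1 f (g1x i)) (fy i).
    * exact: (ord0_elim i).
    * exact: (ord0_elim i).
  + rewrite [g _]gr.
    apply: (@cliffordWeyl_hom_ext _ _ _ _ (f \o g2) tr) => i.
    * exact: etrans (congr1 f (g2w i)) (f_twist _ _ (fv i)).
    * exact: etrans (congr1 f (g2p i)) (f_twist _ _ (fp i)).
    * exact: etrans (congr1 f (g2q i)) (f_twist _ _ (fq i)).
Qed.

Theorem mainTheorem1 (R : realType) (m n k : nat) :
  exists f : {lrmorphism cliffordWeyl R[i] (2 * m + n) k ->
                tensorAlg (clifford R[i] (2 * m)) (cliffordWeyl R[i] n k)},
    bijective f.
Proof.
apply: (@cliffordWeyl_tensor _ 'i%C); first exact: sqr_i.
by rewrite Num.Theory.pnatr_eq0.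
Qed.
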